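(* Let $T$ be a tree. For $i\in\{0,1,2\}$, let $E_i\subseteq E(T)$ be such that every edge of $E_i$ is incident with exactly $i$ vertices whose degree in $T$ is at most $2$. Then for every $k$ with $\frac13\le k\le\frac12$, the graph $T-(E_0\cup E_1\cup E_2)$ has at least $1+k|E_0|+(1-k)|E_1|+|E_2|$ components that contain a vertex whose degree in $T$ is at most $2$.
   Context: $T-E$ denotes the spanning subgraph of $T$ obtained by deleting the edge set $E$ (keeping all vertices). *)

(* Defs.v *)
From mathcomp Require Import all_boot all_order all_algebra.

Set Implicit Arguments.
Unset Strict Implicit.
Unset Printing Implicit Defensive.

(* A finite simple graph is a symmetric irreflexive relation [g : rel V] on a
   finite type; its edges are the two-element sets [set x; y] with [g x y]. *)
Section Graphs.

Variables (V : finType) (g : rel V).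

Definition simple_graph : Prop := symmetric g /\ irreflexive g.

Definition edges : {set {set V}} :=
  [set f | [exists x, exists y, g x y && (f == [set x; y])]].

Definition degree (x : V) : nat := #|[set y | g x y]|.

Definition connected_graph : Prop :=
  (exists x : V, True) /\ forall x y : V, connect g x y.

(* [ucycle] also accepts sequences of length at most 2, which are not graph
   cycles. *)
Definition acyclic : Prop :=
  forall c : seq V, 3 <= size c -> ~ ucycle g c.

Definition tree : Prop := [/\ simple_graph, connected_graph & acyclic].

Definition del_edges (E : {set {set V}}) : rel V :=
  fun x y => g x y && ([set x; y] \notin E).

Definition components : {set {set V}} :=
  [set [set y | connect g x y] | x : V].

Definition low_degree : {set V} := [set x | degree x <= 2].

End Graphs.

(* Main.v *)
Require Import Defs.
From mathcomp Require Import all_boot all_order all_algebra.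
From mathcomp Require Import zify lra.

(** Let F be the set of deleted edges and call a component of T - F bad if all
    its vertices have degree at least 3. Since T - F has at least 1 + |F|
    components, the claim is b <= (1 - k)|E0| + k|E1| for the number b of bad
    ones. Let B be the union of the bad components. The degrees in T of its
    vertices add up to at least 3|B|, while T - F has at most |B| - b edges
    inside B and T at most |B|, because both are forests. Hence F-edges have at
    least |B| + 2b >= 3b ends in B, which gives 3b <= 2|E0| + |E1|, and at
    least |B| + b >= 2b of them meet B, which gives 2b <= |E0| + |E1|. The
    claim is the combination of these two bounds with the weights 1 - 2k and
    3k - 1, nonnegative for 1/3 <= k <= 1/2. *)

Import Order.TTheory GRing.Theory Num.Theory.
Local Open Scope ring_scope.

Section Forests.

Set Implicit Arguments.
Unset Strict Implicit.
Local Open Scope nat_scope.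

(** * Edge sets, induced subgraphs and degree sums *)

Variable V : finType.
Implicit Types (g h : rel V) (B : {set V}) (F : {set {set V}}).

(** The vertex type stays [V]: vertices outside [B] become isolated, which accounts for the terms
    [#|V| - #|B|] below. *)
Definition induced g B : rel V := fun x y => [&& g x y, x \in B & y \in B].

Lemma edgesP g f :
  reflect (exists x y, g x y /\ f = [set x; y]) (f \in edges g).
Proof.
rewrite inE; apply: (iffP existsP) => [[x /existsP[y /andP[gxy /eqP->]]]|].
  by exists x, y.
by case=> x [y [gxy ->]]; exists x; apply/existsP; exists y; rewrite gxy eqxx.
Qed.

Lemma mem_edges g x y : g x y -> [set x; y] \in edges g.
Proof. by move=> gxy; apply/edgesP; exists x, y. Qed.

Lemma simple_del_edges g F : simple_graph g -> simple_graph (del_edges g F).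
Proof.
case=> gC gI; split=> [x y|x]; last by rewrite /del_edges gI.
by rewrite /del_edges gC setUC.
Qed.

Lemma simple_induced g B : simple_graph g -> simple_graph (induced g B).
Proof.
case=> gC gI; split=> [x y|x]; last by rewrite /induced gI.
by rewrite /induced gC; case: (x \in B); case: (y \in B).
Qed.

Lemma sub_acyclic g h : subrel h g -> acyclic g -> acyclic h.
Proof.
move=> hg acg c szc /andP[hc uc]; apply: (acg c szc).
by rewrite /ucycle uc andbT; apply: sub_cycle hc.
Qed.

Lemma edges_del_edges g F :
  symmetric g -> edges (del_edges g F) = edges g :\: F.
Proof.
move=> gC; apply/setP => f; rewrite in_setD.
apply/edgesP/andP => [[x [y [/andP[gxy nF] ->]]]|[nF /edgesP[x [y [gxy def_f]]]]].
  by rewrite nF mem_edges.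
by exists x, y; rewrite /del_edges gxy -def_f.
Qed.

Lemma edges_induced g B : edges (induced g B) = [set f in edges g | f \subset B].
Proof.
apply/setP => f; rewrite inE; apply/edgesP/andP.
  case=> x [y [/and3P[gxy Bx By] ->]]; split; first exact: mem_edges.
  by rewrite subUset !sub1set Bx.
case=> /edgesP[x [y [gxy def_f]]]; rewrite def_f subUset !sub1set => /andP[Bx By].
by exists x, y; rewrite /induced gxy Bx By.
Qed.

Lemma degreeE g x : simple_graph g -> degree g x = #|[set f in edges g | x \in f]|.
Proof.
case=> gC gI; rewrite /degree -(@card_in_imset _ _ (fun y => [set x; y])).
  congr #|pred_of_set _|; apply/setP => f; rewrite inE; apply/imsetP/andP.
    by case=> y; rewrite inE => gxy ->; rewrite mem_edges ?set21.
  case=> /edgesP[u [v [guv ->]]]; rewrite !inE => /orP[]/eqP->.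
    by exists v; rewrite ?inE.
  by exists u; rewrite ?inE 1?gC // setUC.
move=> y z; rewrite !inE => gxy gxz /setP/(_ y); rewrite !inE eqxx orbT.
by case: eqP => [yx|_ /esym/eqP //]; rewrite yx gI in gxy.
Qed.

(** Double counting of the incidences between vertices of [B] and edges. *)
Lemma sum_degree g B : simple_graph g ->
  \sum_(x in B) degree g x = \sum_(f in edges g) #|f :&: B|.
Proof.
move=> sg; under eq_bigr => x _ do rewrite degreeE // -sum1_card.
under [RHS]eq_bigr => f _ do rewrite -sum1_card.
rewrite (exchange_big_dep (mem (edges g))) /=; last by move=> x f _; rewrite inE => /andP[].
by apply: eq_bigr => f fE; apply: eq_bigl => x; move: fE; rewrite !inE => ->; rewrite andbC.
Qed.

Lemma card_edge g f : simple_graph g -> f \in edges g -> #|f| = 2.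
Proof.
case=> _ gI /edgesP[x [y [gxy ->]]]; rewrite cards2.
by case: eqP gxy => // ->; rewrite gI.
Qed.

(** * Components after deleting edges from a forest *)

Lemma acyclic_disconnect g h x y : acyclic g -> subrel h g -> g y x ->
  x != y -> ~~ h x y -> ~~ connect h x y.
Proof.
move=> acg hg gyx neq nhxy; apply/negP => /connectP[p hp lastp].
case/shortenP: hp lastp => p' hp' up _ lastp.
(* A repetition-free [h]-path from [x] to [y] closes up through the edge [g y x] to a cycle. It has
   at least three vertices, since [x != y] and [h x y] fails. *)
apply: (acg (x :: p')); last first.
  by rewrite /ucycle up andbT /= rcons_path (sub_path hg hp') -lastp.
case: p' hp' lastp {up} => [|z [|//]] /=; first by move=> _ eq; rewrite eq eqxx in neq.
by rewrite andbT => hxz eq; rewrite eq hxz in nhxy.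
Qed.

(** The map [up] sends each [h]-component to the [g]-component containing it. It is onto, but not
    injective: the distinct [h]-components of [x] and [y] have the same image. *)
Lemma components_lt g h x y : symmetric g -> subrel h g ->
  connect g x y -> ~~ connect h x y -> #|components g| < #|components h|.
Proof.
move=> gC hg gxy nhxy.
have hgc : forall u v, connect h u v -> connect g u v.
  by apply: connect_sub => u v huv; apply/connect1/hg.
pose up (C : {set V}) := [set v | [exists u in C, connect g u v]].
have upE u : up [set v | connect h u v] = [set v | connect g u v].
  apply/setP => v; rewrite !inE; apply/exists_inP/idP => [[w]|guv].
    by rewrite inE => /hgc guw; apply: connect_trans.
  by exists u; rewrite // inE.
have -> : components g = up @: components h.
  by rewrite /components -imset_comp; apply: eq_imset => u /=; rewrite upE.
rewrite ltn_neqAle leq_imset_card andbT; apply/negP => /imset_injP inj_up.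
have /setP/(_ y) : [set v | connect h x v] = [set v | connect h y v].
  apply: inj_up; rewrite ?imset_f // !upE; apply/setP => v; rewrite !inE.
  exact: (same_connect (sym_connect_sym gC)).
by rewrite !inE connect0 (negbTE nhxy).
Qed.

Lemma eq_components g h : g =2 h -> components g = components h.
Proof.
move=> gh; apply: eq_imset => x; apply/setP => y.
by rewrite !inE (eq_connect gh).
Qed.

(** Edges are removed one at a time; by acyclicity each removal separates the ends of its edge and
    so raises the number of components. *)
Lemma components_del_edges g F : simple_graph g -> acyclic g ->
  F \subset edges g -> #|components g| + #|F| <= #|components (del_edges g F)|.
Proof.
move=> sg acg; have [gC gI] := sg.
have [n] := ubnP #|F|; elim: n F => // n IHn F ltFn FE.
have [->|[f fF]] := set_0Vmem F.
  rewrite cards0 addn0 (@eq_components g (del_edges g set0)) // => x y.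
  by rewrite /del_edges inE andbT.
have /edgesP[x [y [gxy def_f]]] := subsetP FE _ fF.
have cardF := cardsD1 f F; rewrite fF add1n in cardF.
rewrite cardF addnS; apply: leq_ltn_trans (IHn (F :\ f) _ _) _.
- by rewrite cardF in ltFn.
- exact: subset_trans (subsetDl _ _) FE.
apply: (@components_lt _ _ x y).
- by case: (simple_del_edges (F :\ f) sg).
- by move=> u v; rewrite /del_edges !inE => /andP[-> /negbTE->]; rewrite andbF.
- by apply: connect1; rewrite /del_edges gxy -def_f !inE eqxx.
apply: (acyclic_disconnect acg) => [u v /andP[]//||| ].
- by rewrite gC.
- by apply: contraTneq gxy => ->; rewrite gI.
- by rewrite /del_edges -def_f fF andbF.
Qed.

Lemma leq_card_components g : #|components g| <= #|V|.
Proof. exact: leq_imset_card. Qed.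

Lemma leq_components_edges g : simple_graph g -> acyclic g ->
  #|components g| + #|edges g| <= #|V|.
Proof.
move=> sg acg; apply: leq_trans (leq_card_components (del_edges g (edges g))).
exact: components_del_edges.
Qed.

(** * Components of induced subgraphs *)

Lemma connect_closed_mem g B : (forall x y, g x y -> x \in B -> y \in B) ->
  forall x y, x \in B -> connect g x y = connect (induced g B) x y.
Proof.
move=> clB x y Bx; apply/idP/idP; last first.
  by apply: connect_sub => u v /and3P[guv _ _]; apply: connect1.
case/connectP => p gp ->{y}; elim: p x Bx gp => [|z p IHp] x Bx /=.
  by rewrite connect0.
case/andP=> gxz /(IHp _ (clB _ _ gxz Bx)); apply: connect_trans.
by apply: connect1; rewrite /induced gxz Bx (clB _ _ gxz Bx).
Qed.

Lemma component_induced_out g B x : x \notin B ->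
  [set y | connect (induced g B) x y] = [set x].
Proof.
move=> nBx; apply/setP => y; rewrite !inE; apply/idP/eqP => [|->]; last exact: connect0.
by case/connectP => [[|z p]] //=; rewrite /induced (negbTE nBx) andbF.
Qed.

(** The singletons of vertices outside [B] are further components, distinct from the members of [S]
    because those lie inside [B]. *)
Lemma leq_components_induced g B (S : {set {set V}}) :
    S \subset components (induced g B) -> (forall C, C \in S -> C \subset B) ->
  #|S| + (#|V| - #|B|) <= #|components (induced g B)|.
Proof.
move=> sS SB; have <- : #|[set [set x] | x in ~: B]| = #|V| - #|B|.
  rewrite card_imset; last exact: set1_inj.
  by rewrite cardsCs setCK.
rewrite -cardsUI [X in _ + X](_ : _ = 0) ?addn0.
  apply/subset_leq_card; rewrite subUset sS; apply/subsetP => C /imsetP[x].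
  by rewrite inE => nBx ->; rewrite -(component_induced_out g nBx) imset_f.
apply/eqP; rewrite cards_eq0 -subset0; apply/subsetP => C; rewrite inE.
case/andP=> /SB CB /imsetP[x nBx eqC]; move: CB.
by rewrite eqC sub1set => Bx; rewrite inE Bx in nBx.
Qed.

(** For [L] the low-degree vertices, the sum becomes [2 * #|E0| + #|E1|], and the last set lies in
    the union of [E0] and [E1]. *)
Lemma card_avoiding_components g F (L : {set V}) :
    simple_graph g -> acyclic g -> F \subset edges g ->
    (forall x, x \notin L -> 2 < degree g x) ->
  let b := #|[set C in components (del_edges g F) | C :&: L == set0]| in
  3 * b <= \sum_(f in F) #|f :\: L| /\
  2 * b <= #|[set f in F | ~~ (f \subset L)]|.
Proof.
move=> sg acg FE degL; set h := del_edges g F; set bad := [set C in _ | _] => b.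
have sh : simple_graph h by apply: simple_del_edges.
have [hC _] := sh; have [gC _] := sg.
(* The union of the bad components; it is closed under [h]-adjacency, so bad components survive in
   [induced h B]. *)
pose B := [set x | [set y | connect h x y] :&: L == set0].
have BL x : x \in B -> x \notin L.
  by rewrite inE => /eqP/setP/(_ x); rewrite !inE connect0 /= => ->.
have clB x y : h x y -> x \in B -> y \in B.
  move=> hxy; rewrite !inE => /eqP <-; apply/eqP; congr (_ :&: L).
  apply/setP => z; rewrite !inE; apply/esym.
  exact: (same_connect (sym_connect_sym hC) (connect1 hxy)).
have sub_induced r : subrel (induced r B) r by move=> x y /and3P[].
have subhg : subrel h g by move=> x y /andP[].
have forest r : subrel r g -> simple_graph r ->
    #|components (induced r B)| + #|edges (induced r B)| <= #|V|.
  move=> rg sr; apply: leq_components_edges; first exact: simple_induced.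
  exact: sub_acyclic (sub_acyclic rg acg).
have bad_bound : b + (#|V| - #|B|) <= #|components (induced h B)|.
  apply: leq_components_induced.
    apply/subsetP => C; rewrite inE => /andP[/imsetP[x _ ->] CL].
    have Bx : x \in B by rewrite inE.
    apply/imsetP; exists x => //; apply/setP => y.
    by rewrite !inE (connect_closed_mem clB).
  move=> C; rewrite inE => /andP[/imsetP[x _ ->] CL].
  have Bx : x \in B by rewrite inE.
  apply/subsetP => y; rewrite inE (connect_closed_mem clB) //.
  case/connectP => p; elim: p x Bx {CL} => [|z p IHp] x Bx /=; first by move=> _ ->.
  by case/andP=> /and3P[_ _ Bz]; apply: IHp.
have := forest h subhg sh; have := forest g (fun _ _ => id) sg.
(* With no distinguished components, only the isolated vertices outside [B] are counted; the forest
   bound then leaves at most [#|B|] edges of [g] inside [B]. *)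
have g_bound := @leq_components_induced g B set0 (sub0set _) (fun C => _).
have {}g_bound : #|V| - #|B| <= #|components (induced g B)|.
  by apply: leq_trans (g_bound _); rewrite ?cards0 // => C; rewrite inE.
have leBV := max_card (mem B); have := leq_card_components (induced h B).
set m := #|edges (induced h B)|; pose q := #|[set f in F | f \subset B]|.
have -> : #|edges (induced g B)| = m + q.
  rewrite /m /q !edges_induced edges_del_edges // addnC.
  rewrite -(cardsID F [set f in edges g | f \subset B]); congr (_ + _).
    congr #|pred_of_set _|; apply/setP => f; rewrite !inE.
    by case fF: (f \in F); rewrite ?andbF // andbT; have := subsetP FE _ fF; rewrite inE => ->.
  by congr #|pred_of_set _|; apply/setP => f; rewrite !inE andbA.
(* An edge of [h] that meets [B] lies inside [B], so it contributes 2 to the degree sum and is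
   counted by [m]. *)
have sumB : 3 * #|B| <= \sum_(f in F) #|f :&: B| + 2 * m.
  rewrite mulnC -sum_nat_const; apply: (@leq_trans (\sum_(x in B) degree g x)).
    by apply: leq_sum => x /BL; apply: degL.
  rewrite sum_degree // (big_setID F) /= (setIidPr FE) leq_add2l.
  rewrite mulnC -sum_nat_const -(edges_del_edges F gC) edges_induced.
  rewrite [leqRHS](eq_bigl (fun f => (f \in edges h) && (f \subset B))); last first.
    by move=> f; rewrite inE.
  rewrite big_mkcondr /=; apply: leq_sum => f fh.
  rewrite -(card_edge sh fh); case: ifP => [_|]; first by rewrite subset_leq_card ?subsetIl.
  move=> nfB; rewrite leqn0 cards_eq0; apply: contraFT nfB.
  have /edgesP[x [y [hxy ->]]] := fh; have hyx : h y x by rewrite hC.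
  case/set0Pn => z; rewrite in_setI in_set2 subUset !sub1set => /andP[/orP[]/eqP-> Bz].
    by rewrite Bz (clB _ _ hxy).
  by rewrite Bz (clB _ _ hyx).
have sumL : \sum_(f in F) #|f :&: B| <= \sum_(f in F) #|f :\: L|.
  apply: leq_sum => f _; apply/subset_leq_card/subsetP => x; rewrite inE => /andP[fx /BL nLx].
  by rewrite inE nLx.
(* This holds edge by edge: an edge inside [B] is counted in both terms on the right, one with a
   single end in [B] only in the second, since [B] avoids [L]. *)
have sumq : \sum_(f in F) #|f :&: B| <= q + #|[set f in F | ~~ (f \subset L)]|.
  rewrite /q -!sum1dep_card !big_mkcondr -big_split; apply: leq_sum => f fF /=.
  have := card_edge sg (subsetP FE _ fF).
  have [fB|nfB] := boolP (f \subset B); have [fL|nfL] := boolP (f \subset L) => /= f2.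
  - have /card_gt0P[x fx] : 0 < #|f| by rewrite f2.
    by have := BL _ (subsetP fB _ fx); rewrite (subsetP fL _ fx).
  - by apply: leq_trans (subset_leq_card (subsetIl f B)) _; rewrite f2.
  - rewrite leqn0 cards_eq0 -subset0; apply/subsetP => x; rewrite inE => /andP[fx /BL].
    by rewrite (subsetP fL _ fx).
  rewrite add0n -ltnS -f2; apply: proper_card; rewrite properE subsetIl.
  by apply: contra nfB => /subset_trans; apply; apply: subsetIr.
(* Let s be the sum of [#|f :&: B|], so s >= 3|B| - 2m. The first bound uses m <= |B| - b twice; the
   second subtracts q and uses m <= |B| - b and m + q <= |B| once each. Both end with b <= |B|. *)
by split; lia.
Qed.

End Forests.

Theorem lemma4p2 (V : finType) (T : rel V) (E0 E1 E2 : {set {set V}})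
    (R : realFieldType) (k : R) :
  tree T ->
  E0 \subset edges T -> E1 \subset edges T -> E2 \subset edges T ->
  (forall f, f \in E0 -> #|f :&: low_degree T| = 0%N) ->
  (forall f, f \in E1 -> #|f :&: low_degree T| = 1%N) ->
  (forall f, f \in E2 -> #|f :&: low_degree T| = 2%N) ->
  3^-1 <= k -> k <= 2^-1 ->
  1 + k * #|E0|%:R + (1 - k) * #|E1|%:R + #|E2|%:R
    <= #|[set C in components (del_edges T (E0 :|: E1 :|: E2))
            | C :&: low_degree T != set0]|%:R.
Proof.
case=> sT [[x0 _] _] acT sE0 sE1 sE2 cE0 cE1 cE2 k3 k2.
set F := _ :|: E2; set L := low_degree T; set good := [set C in _ | _].
have FE : F \subset edges T by rewrite !subUset sE0 sE1.
have disj01 : [disjoint E0 & E1].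
  by apply/pred0P => f /=; apply/negP => /andP[/cE0 + /cE1] => ->.
have disj012 : [disjoint E0 :|: E1 & E2].
  apply/pred0P => f /=; apply/negP => /andP[+ /cE2 f2].
  by rewrite inE => /orP[/cE0|/cE1]; rewrite f2.
have sumF (w : {set V} -> nat) : (\sum_(f in F) w f =
    \sum_(f in E0) w f + \sum_(f in E1) w f + \sum_(f in E2) w f)%N.
  rewrite /F; under eq_bigl do rewrite in_setU.
  rewrite bigU //=; congr (_ + _)%N.
  by under eq_bigl do rewrite in_setU; rewrite bigU.
have cardF : #|F| = (#|E0| + #|E1| + #|E2|)%N by rewrite -!sum1_card sumF.
have cardD i (E : {set {set V}}) : E \subset edges T ->
    (forall f, f \in E -> #|f :&: L| = i) ->
    (\sum_(f in E) #|f :\: L| = #|E| * (2 - i))%N.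
  move=> sE cE; rewrite -sum_nat_const; apply: eq_bigr => f fE.
  by rewrite cardsD (card_edge sT (subsetP sE _ fE)) (cE f fE).
have [] := card_avoiding_components (L := L) sT acT FE.
  by move=> x; rewrite inE -ltnNge.
set bad := [set C in _ | _].
rewrite sumF (cardD _ _ sE0 cE0) (cardD _ _ sE1 cE1) (cardD _ _ sE2 cE2) => le3 le2.
(* Edges of [E2] have both ends in [L], so those not inside [L] belong to [E0] or [E1]. *)
have {}le2 : (2 * #|bad| <= #|E0| + #|E1|)%N.
  apply: (leq_trans le2); apply: leq_trans (leq_card_setU _ _).
  apply/subset_leq_card/subsetP => f; rewrite inE => /andP[].
  rewrite inE => /orP[//|fE2] /negP[]; apply/setIidPl/eqP.
  by rewrite eqEcard subsetIl (cE2 f fE2) (card_edge sT (subsetP sE2 _ fE2)).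
have comps : (1 + #|F| <= #|bad| + #|good|)%N.
  apply: (@leq_trans #|components (del_edges T F)|).
    apply: leq_trans (components_del_edges sT acT FE); rewrite leq_add2r.
    by apply/card_gt0P; exists [set y | connect T x0 y]; rewrite imset_f.
  rewrite -(cardsID [set C | C :&: L == set0] (components _)).
  by apply: leq_add; apply/subset_leq_card/subsetP => C; rewrite !inE // andbC.
have {}le3 : (3 * #|bad| <= 2 * #|E0| + #|E1|)%N by lia.
rewrite cardF in comps.
move: le3 le2 comps; rewrite -!(ler_nat R) !(natrM, natrD) => le3 le2 comps.
(* With weights 1 - 2k on [le3] and 3k - 1 on [le2], the coefficients of [#|bad|], [#|E0|] and
   [#|E1|] become 1, 1 - k and k; [comps] then gives the claim. *)
have a_ge0 : 0 <= 1 - 2 * k by lra.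
have b_ge0 : 0 <= 3 * k - 1 by lra.
have := ler_wpM2l a_ge0 le3; have := ler_wpM2l b_ge0 le2.
lra.
Qed.
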